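(* Let $q$ be a prime power and let $n,k,\ell$ be non-negative integers with $\ell+2\le k\le 2n-\ell-2$ and $k-\ell$ even. Set $a=k-\ell$ and $b=2n-k-\ell$ (both even). Then $$A^S_{2n,k,\ell,q}=\alpha^S_{2n,k,\ell,q}\cdot(q^{\ell+1}-1)(q^{\ell+2}-1)\cdot A^S_{2n,k,\ell+2,q},$$ where $$\alpha^S_{2n,k,\ell,q}=\frac{q^{a+b-2}}{(q^{a}-1)(q^{b}-1)}.$$
   Context: For a prime power $q$, the symplectic inner product on $\mathbb{F}_q^{2n}$ is $\langle\mathbf{x},\mathbf{y}\rangle_S=\sum_{i=1}^n(x_iy_{n+i}-x_{n+i}y_i)$. For a linear subspace $C\subseteq\mathbb{F}_q^{2n}$, its symplectic dual is $C^{\perp_S}=\{\mathbf{y}\in\mathbb{F}_q^{2n}:\langle\mathbf{x},\mathbf{y}\rangle_S=0\ \forall\mathbf{x}\in C\}$ and its symplectic hull is $\mathrm{Hull}_S(C)=C\cap C^{\perp_S}$. The number $A^S_{2n,k,\ell,q}$ is the number of $k$-dimensional subspaces $C\subseteq\mathbb{F}_q^{2n}$ with $\dim\mathrm{Hull}_S(C)=\ell$. *)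

(* Defs.v *)
From HB Require Import structures.
From mathcomp Require Import all_boot all_order all_algebra.
Set Implicit Arguments.
Unset Strict Implicit.
Unset Printing Implicit Defensive.
Import Order.TTheory GRing.Theory Num.Theory.
Local Open Scope ring_scope.

(* Over a finite field the subspaces of a vector space form a finite type,    *)
(* so that they can be counted with #|_|.                                     *)
Import VectorInternalTheory.
HB.instance Definition _ (F : finFieldType) (vT : vectType F) :=
  [Countable of {vspace vT} by <:].
HB.instance Definition _ (F : finFieldType) (vT : vectType F) :=
  [Finite of {vspace vT} by <:].

Section Symplectic.
Variables (F : fieldType) (n : nat).

(* F^(2n) is 'rV[F]_(n + n): the coordinates x_i and x_{n+i} are              *)
(* x 0 (lshift n i) and x 0 (rshift n i).                                     *)
Definition sympform (x y : 'rV[F]_(n + n)) : F :=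
  \sum_(i < n) (x 0 (lshift n i) * y 0 (rshift n i)
                - x 0 (rshift n i) * y 0 (lshift n i)).

Fact sympform_bilinear :
  bilinear_for (GRing.Scale.Law.clone F F *%R _)
    (GRing.Scale.Law.clone F F (idfun \; *%R) _) sympform.
Proof.
split=> z a x y; rewrite /sympform /= mulr_sumr -big_split;
  apply: eq_bigr => i _ /=.
  by rewrite !mxE !mulrDl -!mulrA opprD addrACA -mulrBr.
by rewrite !mxE !mulrDr opprD addrACA !(mulrCA _ a) mulrN.
Qed.

HB.instance Definition _ :=
  bilinear_isBilinear.Build F 'rV[F]_(n + n) 'rV[F]_(n + n) F *%R
    (idfun \; *%R) sympform sympform_bilinear.

Fact sympform_skew (x y : 'rV[F]_(n + n)) :
  sympform x y = (-1) ^+ true * idfun (sympform y x).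
Proof.
rewrite expr1 mulN1r /= -sumrN; apply: eq_bigr => i _.
by rewrite opprB mulrC [X in _ - X]mulrC.
Qed.

HB.instance Definition _ :=
  isHermitianSesquilinear.Build F 'rV[F]_(n + n) true idfun sympform
    sympform_skew.

Definition sympdual (C : {vspace 'rV[F]_(n + n)}) : {vspace 'rV[F]_(n + n)} :=
  orthov (sympform : {skew_symmetric 'rV[F]_(n + n)}) C.

Lemma sympdualP (C : {vspace 'rV[F]_(n + n)}) (y : 'rV[F]_(n + n)) :
  reflect (forall x, x \in C -> sympform x y = 0) (y \in sympdual C).
Proof.
apply: (iffP (@mem_orthovP F true idfun _ sympform C y)) => yC x xC.
  by rewrite sympform_skew [sympform y x]yC ?mulr0.
rewrite -[LHS]/(sympform y x) sympform_skew yC ?mulr0 //.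
Qed.

Definition symphull (C : {vspace 'rV[F]_(n + n)}) : {vspace 'rV[F]_(n + n)} :=
  (C :&: sympdual C)%VS.

End Symplectic.

Definition symphull_count (F : finFieldType) (n k l : nat) : nat :=
  #|[set C : {vspace 'rV[F]_(n + n)} | (\dim C == k)
                                       && (\dim (symphull C) == l)]|.

(* a = k - l and b = 2n - k - l are computed in nat: the subtractions are     *)
(* genuine as soon as l <= k <= 2n - l.                                       *)
Definition symphull_alpha (n k l q : nat) : rat :=
  let a := (k - l)%N in
  let b := (2 * n - k - l)%N in
  q%:R ^+ (a + b - 2) / ((q%:R ^+ a - 1) * (q%:R ^+ b - 1)).

(* Main.v *)
Require Import Defs.
From mathcomp Require Import all_boot all_order all_algebra all_field.
From mathcomp Require Import zify ring.

(** The number of k-dimensional C with hull dimension l is compared with the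
    number for l + 2 by way of an intermediate layer, the (k - 1)-dimensional D
    with hull dimension l + 1.  When D is a hyperplane of C, passing from D to C
    moves the hull dimension by exactly one: up if C is contained in
    Hull(D)^perp = D + D^perp ([dim_symphull_cover_sub]), because C is then D
    plus a vector orthogonal to D, which joins the hull; down otherwise
    ([dim_symphull_cover_nsub]), because the new vector then cuts a hyperplane
    out of the hull.

    The number of such C above a given D is therefore a count of the
    one-dimensional extensions of D inside D + D^perp, whose dimension 2n - h
    depends only on the hull dimension h of D, and inside the whole space
    ([card_covers]).  The number of D below a given C needs no separate argument:
    C |-> C^perp reverses inclusions and preserves hulls.  Counting the flags
    D < C in two ways gives [symphull_count_step]: with N(d, h) the number of
    d-dimensional spaces with hull dimension h,

      N(d, h) (q^(2n-d-h) - 1) = N(d+1, h+1) q^(d-h) (q^(h+1) - 1).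

    At (d, h) = (k - 1, l + 1) this relates the intermediate layer to l + 2.  At
    (2n - k, l), after dualising, it relates l to the intermediate layer, since
    N(2n - k, l) = N(k, l) and N(2n - k + 1, l + 1) = N(k - 1, l + 1).
    Multiplying the two relations eliminates the intermediate count. *)

Set Implicit Arguments.
Unset Strict Implicit.
Import Order.TTheory GRing.Theory Num.Theory.
Local Open Scope ring_scope.

(** * Extensions of a subspace by one dimension *)

Section Covers.
Variables (F : fieldType) (vT : vectType F).
Implicit Types (C D W : {vspace vT}) (v : vT).

Lemma dim_addv_line D v : v \notin D -> \dim (D + <[v]>)%VS = (\dim D).+1.
Proof.
move=> vD; have vn0 : v != 0 by apply: contraNneq vD => ->; apply: mem0v.
have cap0 : (D :&: <[v]> = 0)%VS.
  apply/eqP; rewrite -subv0; apply/subvP => x /memv_capP[xD /vlineP[c xE]].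
  have [c0 | cn0] := eqVneq c 0; first by rewrite xE c0 scale0r mem0v.
  by move: xD; rewrite xE rpredZeq (negPf cn0) (negPf vD).
by rewrite dimv_disjoint_sum // dim_vline vn0 addn1.
Qed.

Lemma cover_addv_line C D v : (D <= C)%VS -> \dim C = (\dim D).+1 ->
  v \in C -> v \notin D -> C = (D + <[v]>)%VS.
Proof.
move=> DC dimC vC vD; apply/eqP; rewrite eq_sym eqEdim dim_addv_line // dimC.
by rewrite leqnn andbT subv_add DC -memvE.
Qed.

End Covers.

Lemma dimvf_rV (F : fieldType) (m : nat) : \dim {:'rV[F]_m} = m.
Proof. by rewrite dimvf dim_matrix; apply: mul1n. Qed.

(** Each vector of W outside D spans with D exactly one such C, and each C arises
    from the q^(d+1) - q^d vectors of C outside D, where d = dim D. *)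
Lemma card_covers (F : finFieldType) (m : nat) (D W : {vspace 'rV[F]_m}) :
  (D <= W)%VS ->
  (#|[set C : {vspace 'rV[F]_m} | [&& (D <= C)%VS, (C <= W)%VS
                                    & \dim C == (\dim D).+1]]|
     * (#|F| ^ (\dim D).+1 - #|F| ^ \dim D) = #|F| ^ \dim W - #|F| ^ \dim D)%N.
Proof.
move=> DW; set X := [set C | _].
have cardD (A : {vspace 'rV[F]_m}) : (D <= A)%VS ->
    #|[set v | (v \in A) && (v \notin D)]| = (#|F| ^ \dim A - #|F| ^ \dim D)%N.
  move=> DA; rewrite -!(@card_vspace F 'rV[F]_m).
  rewrite -(cardsE (mem A)) -(cardsE (mem D)) -cardsDS.
    by apply: eq_card => v; rewrite !inE andbC.
  by apply/subsetP => v; rewrite !inE; apply: (subvP DA).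
rewrite -cardD // -[RHS]sum1_card -sum_nat_const.
rewrite (partition_big (fun v => (D + <[v]>)%VS) (mem X)) /=; last first.
  move=> v /[!inE] /andP[vW vD].
  by rewrite addvSl subv_add DW -memvE vW dim_addv_line /=.
apply: eq_bigr => C /[!inE] /and3P[DC CW /eqP dimC].
rewrite -dimC -cardD // -[LHS]sum1_card; apply: eq_bigl => v /[!inE].
have [vD | vD] := boolP (v \in D); rewrite ?andbF //= !andbT.
apply/idP/andP => [vC | [_ /eqP <-]]; last by rewrite memvE addvSr.
by rewrite (subvP CW) // -(cover_addv_line DC).
Qed.

(** * Symplectic duality *)

Section Dual.
Variables (F : fieldType) (n : nat).
Implicit Types (C D U V : {vspace 'rV[F]_(n + n)}) (x y : 'rV[F]_(n + n)).

Lemma sympformC0 x y : sympform x y = 0 -> sympform y x = 0.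
Proof. by rewrite [sympform y x]sympform_skew /= => ->; rewrite mulr0. Qed.

Lemma sympform_alternating x : sympform x x = 0.
Proof. by apply: big1 => i _; rewrite mulrC subrr. Qed.

Lemma sympdualS U V : (U <= V)%VS -> (sympdual V <= sympdual U)%VS.
Proof.
move=> UV; apply/subvP => y /sympdualP yV; apply/sympdualP => x xU.
by apply: yV; apply: (subvP UV).
Qed.

Lemma sub_sympdualC U V : (U <= sympdual V)%VS = (V <= sympdual U)%VS.
Proof.
wlog suff sub : U V / (U <= sympdual V)%VS -> (V <= sympdual U)%VS.
  by apply/idP/idP; apply: sub.
move=> /subvP UV; apply/subvP => y yV; apply/sympdualP => x /UV /sympdualP xV.
by apply/sympformC0/xV.
Qed.

Lemma sympdualD U V : sympdual (U + V) = (sympdual U :&: sympdual V)%VS.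
Proof.
apply/eqP; rewrite eqEsubv subv_cap !sympdualS ?addvSl ?addvSr //=.
by rewrite sub_sympdualC subv_add ![(_ <= sympdual (_ :&: _))%VS]sub_sympdualC
           capvSl capvSr.
Qed.

Lemma sympdualf : sympdual (fullv : {vspace 'rV[F]_(n + n)}) = 0%VS.
Proof.
apply/eqP; rewrite -subv0; apply/subvP => y /sympdualP yf; rewrite memv0.
apply/eqP/rowP => i; rewrite mxE.
have [j ->|j ->] := split_ordP i.
- have := yf (delta_mx 0 (rshift n j)) (memvf _); rewrite /sympform.
  rewrite (bigD1 j) //= !mxE !eqxx eq_lrshift mul0r mul1r sub0r big1 => [|k kj].
    by rewrite addr0 => /eqP; rewrite oppr_eq0 => /eqP.
  by rewrite !mxE eq_lrshift (inj_eq (@rshift_inj _ _)) (negPf kj) !mul0r subr0.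
have := yf (delta_mx 0 (lshift n j)) (memvf _); rewrite /sympform.
rewrite (bigD1 j) //= !mxE !eqxx eq_rlshift mul0r mul1r subr0 big1 => [|k kj].
  by rewrite addr0.
by rewrite !mxE eq_rlshift (inj_eq (@lshift_inj _ _)) (negPf kj) !mul0r subr0.
Qed.

(** Orthogonality to one more vector lowers the dimension by at most one. *)
Lemma dim_sympdual_geq C : (n + n <= \dim C + \dim (sympdual C))%N.
Proof.
rewrite -[C in sympdual C](span_basis (vbasisP C)) -{1}(size_tuple (vbasis C)).
elim: (tval _) => [|u s IHs] /=.
  by rewrite span_nil /sympdual orthov0 dimvf_rV.
rewrite span_cons sympdualD capvC.
have := leq_dim_orthov1 (@sympform F n : {skew_symmetric 'rV[F]_(n + n)}) u
  (sympdual <<s>>); rewrite -/(sympdual <[u]>) => le1.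
apply: leq_trans IHs _; rewrite addSn -addnS leq_add2l.
by apply: leq_trans (leqSpred _) _; rewrite ltnS.
Qed.

(** The bound just obtained, applied to C and to a complement C', is an equality
    for both: C^perp and C'^perp meet trivially, as their intersection is
    orthogonal to the whole space. *)
Lemma dim_sympdual C : (\dim C + \dim (sympdual C) = n + n)%N.
Proof.
apply/eqP; rewrite eqn_leq dim_sympdual_geq andbT.
have := dim_sympdual_geq C^C; have dimC := dimv_compl C.
have := dimv_sum_cap (sympdual C) (sympdual C^C).
rewrite -sympdualD addv_complf sympdualf dimv0 addn0 => dim_sum.
have := dimvS (subvf (sympdual C + sympdual C^C)).
have := dimvS (subvf C).
by rewrite dim_sum dimC dimvf_rV; lia.
Qed.

Lemma dim_sympdual_eq C d : (d <= n + n)%N ->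
  (\dim (sympdual C) == n + n - d)%N = (\dim C == d).
Proof. by have := dim_sympdual C; lia. Qed.

Lemma sympdualK : involutive (@sympdual F n).
Proof.
move=> C; apply/eqP; rewrite eq_sym eqEdim sub_sympdualC subvv /=.
by have := dim_sympdual C; have := dim_sympdual (sympdual C); lia.
Qed.

Lemma sympdual_cap U V : sympdual (U :&: V) = (sympdual U + sympdual V)%VS.
Proof. by rewrite -[RHS]sympdualK sympdualD !sympdualK. Qed.

Lemma sympdual_leq U V : (sympdual V <= sympdual U)%VS = (U <= V)%VS.
Proof. by rewrite sub_sympdualC sympdualK. Qed.

Lemma symphull_sympdual C : symphull (sympdual C) = symphull C.
Proof. by rewrite /symphull sympdualK capvC. Qed.

Lemma dim_symphull_leq C : (\dim C + \dim (symphull C) <= n + n)%N.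
Proof. by rewrite -[leqRHS](dim_sympdual C) leq_add2l dimvS ?capvSr. Qed.

(** * The hull under a one-dimensional extension *)

(** The hypothesis on C says that C lies in D + D^perp, so that C is spanned by D
    and a vector orthogonal to D.  The form being alternating, that vector is
    orthogonal to all of C, whence Hull(C) is the intersection of C and D^perp,
    which contains Hull(D) as a hyperplane. *)
Lemma dim_symphull_cover_sub D C : (D <= C)%VS -> \dim C = (\dim D).+1 ->
  (C <= sympdual (symphull D))%VS -> \dim (symphull C) = (\dim (symphull D)).+1.
Proof.
move=> DC dimC Chull.
have hullC : symphull C = (sympdual D :&: C)%VS.
  apply/eqP; rewrite eqEsubv; apply/andP; split.
    by rewrite /symphull capvC capvS ?sympdualS.
  rewrite subv_cap capvSr /=; apply/subvP => x /memv_capP[xD' xC].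
  have [xD | xD] := boolP (x \in D).
    have : x \in symphull D by rewrite memv_cap xD.
    by apply/subvP; rewrite sub_sympdualC.
  rewrite (cover_addv_line DC dimC xC xD) sympdualD memv_cap xD' /=.
  apply/sympdualP => _ /vlineP[c ->].
  by rewrite linearZl_LR /= sympform_alternating mulr0.
(* The modular law, as D <= C <= D + D^perp. *)
have CE : C = (D + (sympdual D :&: C))%VS.
  rewrite vspace_modl //; apply/esym/capv_idPr.
  by move: Chull; rewrite sympdual_cap sympdualK addvC.
have := dimv_sum_cap D (sympdual D :&: C).
rewrite -CE capvA -hullC (capv_idPl (subv_trans (capvSl _ _) DC)).
by rewrite -/(symphull D); lia.
Qed.

(** A vector of Hull(C) outside D would span C together with D while being
    orthogonal to D, placing C inside D + D^perp.  So Hull(C) lies in D, and it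
    consists of the vectors of Hull(D) orthogonal to a new vector of C, which is
    not orthogonal to all of Hull(D). *)
Lemma dim_symphull_cover_nsub D C : (D <= C)%VS -> \dim C = (\dim D).+1 ->
  ~~ (C <= sympdual (symphull D))%VS ->
  (\dim (symphull C)).+1 = \dim (symphull D).
Proof.
move=> DC dimC Chull.
have hullC_D : (symphull C <= D)%VS.
  apply/subvP => x /memv_capP[xC xC']; apply: contraNT Chull => xD.
  rewrite sympdual_cap sympdualK (cover_addv_line DC dimC xC xD) addvC addvS //.
  by rewrite -memvE (subvP (sympdualS DC)).
have /subvPn[v vC v_hull] := Chull.
have vD : v \notin D.
  apply: contra v_hull; apply/subvP.
  by rewrite sub_sympdualC capvSr.
have hullC : symphull C = (symphull D :&: sympdual <[v]>)%VS.
  rewrite /symphull -capvA -sympdualD -(cover_addv_line DC dimC vC vD).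
  by apply/eqP; rewrite eqEsubv subv_cap [(_ <= D)%VS]hullC_D capvSr capvS.
have := eq_dim_orthov1 v_hull; rewrite -/(sympdual <[v]>) -hullC => <-.
rewrite prednK // lt0n dimv_eq0; apply: contra v_hull => /eqP ->.
by rewrite /sympdual orthov0 memvf.
Qed.

End Dual.

(** * Counting flags *)

Section Counting.
Variables (F : finFieldType) (n : nat).
Local Notation space := {vspace 'rV[F]_(n + n)}.
Local Notation q := #|F|.

Definition hull_spaces d h : {set space} :=
  [set C | (\dim C == d) && (\dim (symphull C) == h)].

Lemma symphull_count_dual d h : (d <= n + n)%N ->
  symphull_count F n (n + n - d) h = symphull_count F n d h.
Proof.
move=> le_d; rewrite /symphull_count.
rewrite -[RHS](card_imset _ (inv_inj (@sympdualK F n))).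
apply: eq_card => C; rewrite inE.
rewrite -[in RHS](sympdualK C) mem_imset ?inE; last first.
  exact: inv_inj (@sympdualK F n).
rewrite symphull_sympdual; congr (_ && _).
by rewrite -[RHS]dim_sympdual_eq // sympdualK.
Qed.

(** These C are the one-dimensional extensions of D inside Hull(D)^perp, of
    dimension 2n - h. *)
Lemma card_covers_hullS (D : space) d h : D \in hull_spaces d h ->
  (#|[set C in hull_spaces d.+1 h.+1 | (D <= C)%VS]| * (q ^ d.+1 - q ^ d)
   = q ^ (n + n - h) - q ^ d)%N.
Proof.
rewrite inE => /andP[/eqP dimD /eqP dimH].
have DH : (D <= sympdual (symphull D))%VS by rewrite sub_sympdualC capvSr.
have := card_covers DH; have := dim_sympdual (symphull D).
rewrite dimD dimH => dimH'.
have -> : \dim (sympdual (symphull D)) = (n + n - h)%N by lia.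
move=> <-; congr (_ * _)%N; apply: eq_card => C; rewrite !inE.
have [DC | _] := boolP (D <= C)%VS; rewrite ?andbF //= andbT andbC.
have [/eqP dimC | _] := boolP (\dim C == d.+1); rewrite ?andbF //= andbT.
have dimCD : \dim C = (\dim D).+1 by rewrite dimD.
have [CH | CH] := boolP (C <= _)%VS.
  by rewrite (dim_symphull_cover_sub DC) // dimH eqxx.
have := dim_symphull_cover_nsub DC dimCD CH; rewrite dimH => hE.
by apply/negbTE/eqP => dimHC; rewrite dimHC in hE; lia.
Qed.

(** Every one-dimensional extension of D changes the hull dimension by one, so
    these C are the extensions of D not counted by [card_covers_hullS]. *)
Lemma card_covers_hullP (D : space) d h : D \in hull_spaces d h.+1 ->
  (#|[set C in hull_spaces d.+1 h | (D <= C)%VS]| * (q ^ d.+1 - q ^ d)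
   = q ^ (n + n) - q ^ (n + n - h.+1))%N.
Proof.
move=> DX; have := card_covers_hullS DX.
move: DX; rewrite inE => /andP[/eqP dimD /eqP dimH].
have := card_covers (subvf D); rewrite dimvf_rV dimD.
set A := [set C | [&& _, _ & _]]; set B := [set C in hull_spaces _ h.+2 | _].
set E := [set C in hull_spaces _ h | _].
have -> : A = B :|: E.
  apply/setP => C; rewrite !inE subvf /=.
  have [DC | _] := boolP (D <= C)%VS; rewrite ?andbF //= !andbT.
  have [/eqP dimC | _] := boolP (\dim C == d.+1); rewrite ?andbF //=.
  have dimCD : \dim C = (\dim D).+1 by rewrite dimD.
  have [CH | CH] := boolP (C <= sympdual (symphull D))%VS.
    by rewrite (dim_symphull_cover_sub DC) // dimH eqxx.
  have := dim_symphull_cover_nsub DC dimCD CH; rewrite dimH => -[->].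
  by rewrite eqxx orbT.
have BE0 : B :&: E = set0.
  apply/setP => C; rewrite !inE; apply/negP.
  by move=> /andP[/andP[/andP[_ /eqP ->] _]]; rewrite [h.+2 == h]gtn_eqF ?andbF.
have cardBE : #|B :|: E| = (#|B| + #|E|)%N by rewrite cardsU BE0 cards0 subn0.
rewrite [#|B :|: E|]cardBE mulnDl.
have q_gt0 : (0 < q)%N by apply/card_gt0P; exists 0.
have /(leq_pexp2l q_gt0) : (d <= n + n - h.+1)%N.
  by have := dim_symphull_leq D; rewrite dimD dimH; lia.
have /(leq_pexp2l q_gt0) : (n + n - h.+1 <= n + n)%N by lia.
lia.
Qed.

(** The hyperplanes D of C correspond under duality to the one-dimensional
    extensions D^perp of C^perp, and the hulls do not change. *)
Lemma card_hyperplanes_hullP (C : space) d h : C \in hull_spaces d.+1 h.+1 ->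
  (#|[set D in hull_spaces d h | (D <= C)%VS]|
     * (q ^ (n + n - d) - q ^ (n + n - d.+1))
   = q ^ (n + n) - q ^ (n + n - h.+1))%N.
Proof.
move=> CX; have lt_d : (d.+1 <= n + n)%N.
  move: CX; rewrite inE => /andP[/eqP <- _].
  by have := dim_symphull_leq C; lia.
have : sympdual C \in hull_spaces (n + n - d.+1)%N h.+1.
  by move: CX; rewrite !inE symphull_sympdual dim_sympdual_eq.
move/card_covers_hullP => <-.
have -> : (n + n - d.+1).+1 = (n + n - d)%N by lia.
congr (_ * _)%N; rewrite -(card_imset _ (inv_inj (@sympdualK F n))).
apply: eq_card => D; rewrite -[D in LHS]sympdualK mem_imset; last first.
  exact: inv_inj (@sympdualK F n).
rewrite !inE symphull_sympdual -[(_ <= D)%VS]sympdual_leq sympdualK.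
by rewrite -(@dim_sympdual_eq _ _ (sympdual D)) ?(ltnW lt_d) // sympdualK.
Qed.

(** Both sides count, up to the common factor q - 1, the flags D < C in which D has
    dimension d and hull dimension h, while C has d + 1 and h + 1. *)
Lemma symphull_count_step d h : (h <= d)%N -> (d + h < n + n)%N ->
  (symphull_count F n d h)%:R * (q%:R ^+ (n + n - d - h) - 1) =
  (symphull_count F n d.+1 h.+1)%:R * (q%:R ^+ (d - h) * (q%:R ^+ h.+1 - 1))
  :> rat.
Proof.
move=> le_hd lt_dh.
(* The numbers of C above D and of D below C are known after multiplication by
   up and by down, each a power of q times q - 1. *)
pose up := (q ^ d.+1 - q ^ d)%N.
pose down := (q ^ (n + n - d) - q ^ (n + n - d.+1))%N.
have count2 : (\sum_(D in hull_spaces d h)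
      #|[set C in hull_spaces d.+1 h.+1 | (D <= C)%VS]|
    = \sum_(C in hull_spaces d.+1 h.+1)
      #|[set D in hull_spaces d h | (D <= C)%VS]|)%N.
  under eq_bigr do rewrite -sum1dep_card big_mkcondr /=.
  rewrite exchange_big /=; apply: eq_bigr => C _.
  by rewrite -sum1dep_card big_mkcondr.
have : (symphull_count F n d h * (q ^ (n + n - h) - q ^ d) * down =
        symphull_count F n d.+1 h.+1 * (q ^ (n + n) - q ^ (n + n - h.+1)) * up)%N.
  have sum_up : (\sum_(D in hull_spaces d h)
      #|[set C in hull_spaces d.+1 h.+1 | (D <= C)%VS]| * up
      = symphull_count F n d h * (q ^ (n + n - h) - q ^ d))%N.
    by rewrite (eq_bigr _ (fun D => @card_covers_hullS D d h)) sum_nat_const.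
  have sum_down : (\sum_(C in hull_spaces d.+1 h.+1)
      #|[set D in hull_spaces d h | (D <= C)%VS]| * down
      = symphull_count F n d.+1 h.+1 * (q ^ (n + n) - q ^ (n + n - h.+1)))%N.
    rewrite (eq_bigr _ (fun C => @card_hyperplanes_hullP C d h)).
    by rewrite sum_nat_const.
  by rewrite -sum_up -sum_down -!big_distrl /= count2 mulnAC.
have q_gt1 : (1 < q)%N := finNzRing_gt1 F.
have q_gt0 : (0 < q)%N by apply: ltnW.
move/(congr1 (fun N : nat => N%:R : rat)); rewrite /up /down !natrM !natrB;
  try by apply: leq_pexp2l => //; lia.
rewrite !natrX; set x : rat := q%:R.
have x0 : x != 0 by rewrite pnatr_eq0 -lt0n.
have x1 : x - 1 != 0 by rewrite subr_eq0 gt_eqF // ltr1n.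
(* Exponents are rewritten as sums so that every power of q factors. *)
have [e nE] : exists e, (n + n - d - h = e.+1)%N.
  by exists (n + n - d - h).-1; lia.
have [f dE] : exists f, (d = h + f)%N by exists (d - h)%N; lia.
have -> : (n + n - h = e.+1 + d)%N by lia.
have -> : (n + n - d = e.+1 + h)%N by lia.
have -> : (n + n - d.+1 = e + h)%N by lia.
have -> : (n + n - h.+1 = e + d)%N by lia.
have -> : (n + n = e.+1 + d + h)%N by lia.
have -> : (e.+1 + h - h = e.+1)%N by lia.
have -> : (d - h = f)%N by lia.
rewrite dE; move: (symphull_count _ _ _ _)%:R (symphull_count _ _ _ _)%:R => B A.
rewrite !(exprS, exprD) => eqAB.
have xn0 i : x ^+ i != 0 by apply: expf_neq0.
(* The common factor to cancel is q^(2h+f+e) (q - 1). *)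
apply: (mulfI (mulf_neq0 (mulf_neq0 (xn0 h) (mulf_neq0 (xn0 h) (xn0 f)))
                         (mulf_neq0 (xn0 e) x1))).
by transitivity (A * (x * x ^+ e * (x ^+ h * x ^+ f) - x ^+ h * x ^+ f)
  * (x * x ^+ e * x ^+ h - x ^+ e * x ^+ h)); [ring | rewrite eqAB; ring].
Qed.

End Counting.

Unset Implicit Arguments.

Theorem theorem14 (q : nat) (F : finFieldType) (cardF : #|F| = q)
    (n k l : nat) (lek : (l + 2 <= k)%N) (kle : (k <= 2 * n - l - 2)%N)
    (evenkl : ~~ odd (k - l)) :
  (symphull_count F n k l)%:R =
    symphull_alpha n k l q
    * ((q%:R ^+ (l + 1) - 1) * (q%:R ^+ (l + 2) - 1))
    * (symphull_count F n k (l + 2))%:R :> rat.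
Proof.
rewrite /symphull_alpha -cardF; set x : rat := #|F|%:R.
have x_gt1 : 1 < x by rewrite ltr1n finNzRing_gt1.
have xB1 i : (0 < i)%N -> x ^+ i - 1 != 0.
  by move=> i_gt0; rewrite subr_eq0 gt_eqF // exprn_egt1 // -lt0n.
have := @symphull_count_step F n k.-1 l.+1.
have := @symphull_count_step F n (n + n - k) l.
have -> : (n + n - k).+1 = (n + n - k.-1)%N by lia.
(* Dualise the step taken at (2n - k, l):
   2n - k becomes k and 2n - (k - 1) becomes k - 1. *)
rewrite !symphull_count_dual; try lia.
have -> : (n + n - (n + n - k) - l = k - l)%N by lia.
have -> : (n + n - k - l = 2 * n - k - l)%N by lia.
have -> : (n + n - k.-1 - l.+1 = 2 * n - k - l)%N by lia.
have -> : (k.-1 - l.+1 = k - l - 2)%N by lia.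
have -> : (k.-1.+1 = k)%N by lia.
rewrite -/x addn1 addn2.
move=> /(_ ltac:(lia) ltac:(lia)) step1 /(_ ltac:(lia) ltac:(lia)) step2.
have a_neq0 : x ^+ (k - l) - 1 != 0 by apply: xB1; lia.
have b_neq0 : x ^+ (2 * n - k - l) - 1 != 0 by apply: xB1; lia.
apply: (mulIf (mulf_neq0 a_neq0 b_neq0)).
rewrite mulrA step1 mulrAC step2.
have -> : (k - l + (2 * n - k - l) - 2 = 2 * n - k - l + (k - l - 2))%N by lia.
by rewrite exprD; field; apply/andP.
Qed.
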